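(* Let $n\ge 2$. If $t\in[-1,0]$, then $\alpha(n,t)\le 2(n+1)$, with equality only at $t=-1/n$. Moreover, the Gram matrix of a maximum obtuse almost-equiangular set in $S^{n-1}$ has rank $n$, its only nonzero eigenvalue is $2(1+1/n)$, and the all-ones vector $e\in\mathbb{R}^{2(n+1)}$ is in its kernel. In particular, the barycenter of a maximum obtuse almost-equiangular set is $0$.
   Context: $S^{n-1}=\{x\in\mathbb{R}^n:\|x\|=1\}$ and $x\cdot y$ is the Euclidean inner product. For $t\in[-1,1)$, a set $S\subseteq S^{n-1}$ is $t$-almost-equiangular if every three distinct points $x,y,z\in S$ satisfy $t\in\{x\cdot y,\,x\cdot z,\,y\cdot z\}$. $\alpha(n,t)$ denotes the maximum cardinality of a $t$-almost-equiangular set in $S^{n-1}$. A maximum obtuse almost-equiangular set in $S^{n-1}$ is a $(-1/n)$-almost-equiangular subset of $S^{n-1}$ with exactly $2(n+1)$ (distinct) points. The Gram matrix of $\{x_1,\dots,x_N\}$ is $(x_i\cdot x_j)_{i,j=1}^N$. *)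

(* Defs.v *)
From mathcomp Require Import all_boot all_order all_algebra finmap.
From mathcomp Require Import boolp classical_sets functions cardinality fsbigop reals.

Set Implicit Arguments.
Unset Strict Implicit.
Unset Printing Implicit Defensive.

Import Order.TTheory GRing.Theory Num.Theory.
Local Open Scope classical_set_scope.
Local Open Scope card_scope.
Local Open Scope ring_scope.

Definition dot (R : realType) (n : nat) (x y : 'rV[R]_n) : R :=
  \sum_(i < n) x ord0 i * y ord0 i.

(* The norm `|x| that MathComp-Analysis puts on 'rV[R]_n is the sup norm. *)
Definition enorm (R : realType) (n : nat) (x : 'rV[R]_n) : R :=
  Num.sqrt (dot x x).

Definition unit_sphere (R : realType) (n : nat) : set 'rV[R]_n :=
  [set x | enorm x = 1].

Definition almost_equiangular (R : realType) (n : nat) (t : R)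
    (S : set 'rV[R]_n) : Prop :=
  S `<=` @unit_sphere R n /\
  (forall x y z, S x -> S y -> S z -> x <> y -> x <> z -> y <> z ->
     [\/ dot x y = t, dot x z = t | dot y z = t]).

(* [is_alpha n t a] says that the maximum defining alpha(n,t) exists and equals
   a. The upper bound ranges over arbitrary sets, so that it also rules out
   infinite almost-equiangular sets. *)
Definition is_alpha (R : realType) (n : nat) (t : R) (a : nat) : Prop :=
  (exists2 S : set 'rV[R]_n, almost_equiangular t S & S #= `I_a) /\
  (forall S : set 'rV[R]_n, almost_equiangular t S -> S #<= `I_a).

Lemma is_alpha_unique (R : realType) (n : nat) (t : R) (a b : nat) :
  is_alpha n t a -> is_alpha n t b -> a = b.
Proof.
move=> [[S aS Sa] ua] [[T bT Tb] ub].
apply/eqP; rewrite eqn_leq -!card_le_II.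
by rewrite -(card_le_eql Sa) ub // -(card_le_eql Tb) ua.
Qed.

Definition max_obtuse (R : realType) (n : nat) (S : set 'rV[R]_n) : Prop :=
  almost_equiangular (- n%:R^-1) S /\ S #= `I_(2 * (n + 1)).

Definition gram (R : realType) (n N : nat) (x : 'I_N -> 'rV[R]_n) : 'M[R]_N :=
  \matrix_(i, j) dot (x i) (x j).

Definition barycenter (R : realType) (n : nat) (S : set 'rV[R]_n) : 'rV[R]_n :=
  (#|` fset_set S|%fset)%:R^-1 *: \sum_(x \in S) x.

(* Main.v *)
Require Import Defs.
From mathcomp Require Import all_boot all_order all_algebra finmap.
From mathcomp Require Import boolp classical_sets functions cardinality fsbigop reals.
From mathcomp Require Import ring lra.

Set Implicit Arguments.
Unset Strict Implicit.
Unset Printing Implicit Defensive.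

Import Order.TTheory GRing.Theory Num.Theory.
Local Open Scope classical_set_scope.
Local Open Scope ring_scope.

(** Let [x_1, ..., x_N] be distinct points of a [t]-almost-equiangular set with
    [t <= 0].  The vectors [(x_i, sqrt (- t)) / sqrt (1 - t)] of dimension
    [d = n + 1] are unit vectors with inner products
    [(x_i . x_j - t) / (1 - t)], so among any three of them two are orthogonal:
    this reduces the bound to the case [t = 0] in dimension [n + 1].

    Let [V] be the matrix with these rows, [G = V V^T] and [A = V^T V].  The
    diagonal of [G - 1] vanishes and its off-diagonal support is a graph without
    triangle, hence [tr (G - 1)^3 = 0]; moreover [tr G = N].  Since [A^k] and
    [G^k] have the same trace for [k > 0], this gives
    [tr A^3 - 3 tr A^2 + 2 N = 0].  On the spectrum of [A], which is nonnegative,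
    [u^3 - 3 u^2 + 4 = (u + 1) (u - 2)^2 >= 0]; summing over the [d] eigenvalues
    yields [4 d - 2 N >= 0], with equality only when every eigenvalue is [2].
    Diagonalization is avoided by reading the left-hand side
    [tr ((A - 2) (A + 1) (A - 2))] as the sum of squares
    [|V (A - 2)|^2 + |A - 2|^2] ([mxtrace_frame_defect]).

    If [N = 2 (n + 1)] then [V^T V = 2].  Let [X] be the matrix with rows [x_i]
    and [e] the all-ones column.  The blocks of this identity say that
    [X^T X = 2 (1 - t)], that [sqrt (- t) X^T e = 0] and that
    [- t N = 2 (1 - t)]; the last one forces [t = -1/n], so that [X^T e = 0] and
    [X^T X = 2 (1 + 1/n)] ([almost_equiangular_extremal]).  The claims on the
    Gram matrix [X X^T] and on the barycenter follow from these two equations.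

    The bound concerns finite families; applied to finite subsets it excludes
    infinite sets, so that the maximum defining [alpha (n, t)] is attained
    ([is_alpha_exists]). *)

(** * Systems of vectors whose Gram matrix has no triangle *)

Lemma mxtrace_tr_mul (R : nzRingType) (m p : nat) (A : 'M[R]_(m, p)) :
  \tr (A^T *m A) = \sum_j \sum_i A i j * A i j.
Proof.
by apply: eq_bigr => j _; rewrite mxE; apply: eq_bigr => i _; rewrite mxE.
Qed.

Lemma mxtrace_tr_mul_ge0 (R : realDomainType) (m p : nat) (A : 'M[R]_(m, p)) :
  0 <= \tr (A^T *m A).
Proof.
rewrite mxtrace_tr_mul; apply: sumr_ge0 => j _; apply: sumr_ge0 => i _.
by rewrite -expr2 sqr_ge0.
Qed.

Lemma mxtrace_tr_mul_eq0 (R : realDomainType) (m p : nat) (A : 'M[R]_(m, p)) :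
  \tr (A^T *m A) = 0 -> A = 0.
Proof.
have sq_ge0 j i : 0 <= A i j * A i j by rewrite -expr2 sqr_ge0.
rewrite mxtrace_tr_mul => /eqP; rewrite psumr_eq0; last first.
  by move=> j _; apply: sumr_ge0.
move=> /allP A0; apply/matrixP => i j; rewrite mxE.
have := A0 j (mem_index_enum _); rewrite /= psumr_eq0 // => /allP Aj0.
by have := Aj0 i (mem_index_enum _); rewrite /= mulf_eq0 orbb => /eqP.
Qed.

(** Each term of the expanded trace is a product along a closed walk of length
    three: either the walk stays put at some step and meets the zero diagonal of
    [G - 1], or it runs around a triangle, one of whose sides
    has weight zero. *)
Lemma mxtrace_sub1_cube (R : comNzRingType) (N : nat) (G : 'M[R]_N) :
    (forall i, G i i = 1) ->
    (forall i j k, i != j -> j != k -> k != i -> G i j * G j k * G k i = 0) ->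
  \tr ((G - 1%:M) *m (G - 1%:M) *m (G - 1%:M)) = 0.
Proof.
move=> G_diag G_triangle.
rewrite /mxtrace big1 // => i _; rewrite mxE big1 // => k _.
rewrite mxE mulr_suml big1 // => j _; rewrite !mxE.
have [<-|ij] := eqVneq i j; first by rewrite G_diag subrr !mul0r.
have [<-|jk] := eqVneq j k; first by rewrite G_diag subrr mulr0 mul0r.
have [->|ki] := eqVneq k i; first by rewrite G_diag subrr mulr0.
by rewrite !subr0 G_triangle.
Qed.

Section TriangleFree.
Variables (R : realFieldType) (N d : nat) (V : 'M[R]_(N, d)).
Hypothesis unit_rows : forall i, (V *m V^T) i i = 1.
Hypothesis triangle_free : forall i j k, i != j -> j != k -> k != i ->
  (V *m V^T) i j * (V *m V^T) j k * (V *m V^T) k i = 0.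

(** The polynomial identity [(u + 1) (u - 2)^2 = (u^3 - 3 u^2 + 2 u) - 2 u + 4]
    at [u = V^T V]: the bracket has trace zero by [mxtrace_sub1_cube], and [u]
    has trace [N].  The factor [u - 2] is squared because [u = 2] is the case of
    equality, and [u + 1] is what splits the left-hand side into two squares. *)
Lemma mxtrace_frame_defect (B := V^T *m V - 2%:M) :
  \tr ((V *m B)^T *m (V *m B)) + \tr (B^T *m B) = 4 * d%:R - 2 * N%:R.
Proof.
have := mxtrace_sub1_cube unit_rows triangle_free.
pose A := V^T *m V; pose G := V *m V^T; rewrite {}/B -/A -/G.
have trG1 : \tr G = N%:R.
  by rewrite /mxtrace (eq_bigr (fun=> 1)) // sumr_const card_ord.
have trA1 : \tr A = N%:R by rewrite -trG1 /A mxtrace_mulC.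
have trA2 : \tr (A *m A) = \tr (G *m G).
  by rewrite /A /G -mulmxA mxtrace_mulC !mulmxA.
have trA3 : \tr (A *m A *m A) = \tr (G *m G *m G).
  by rewrite /A /G -!mulmxA mxtrace_mulC !mulmxA.
have AT : (A - 2%:M)^T = A - 2%:M.
  by rewrite linearB /= tr_scalar_mx /A trmx_mul trmxK.
rewrite trmx_mul AT mulmxA -(mulmxA _ V^T V) -/A.
rewrite !(mulmxBl, mulmxBr, mul_mx_scalar, mul_scalar_mx, scale1r).
rewrite -?scalemxAl !(linearB, linearZ) /=.
rewrite !mxtrace_scalar -trA2 -trA3 trA1 trG1.
rewrite -[in 2 *+ d]mulr_natr => h.
lra.
Qed.

Lemma triangle_free_bound : (N <= 2 * d)%N.
Proof.
rewrite -(ler_nat R) natrM.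
have /= := mxtrace_frame_defect.
have := mxtrace_tr_mul_ge0 (V *m (V^T *m V - 2%:M)).
have := mxtrace_tr_mul_ge0 (V^T *m V - 2%:M).
lra.
Qed.

Lemma triangle_free_extremal : N = (2 * d)%N -> V^T *m V = 2%:M.
Proof.
move=> Nd; have := congr1 (fun k => k%:R : R) Nd; rewrite natrM => NdR.
apply/eqP; rewrite -subr_eq0; apply/eqP.
apply: mxtrace_tr_mul_eq0.
have /= := mxtrace_frame_defect.
have := mxtrace_tr_mul_ge0 (V *m (V^T *m V - 2%:M)).
have := mxtrace_tr_mul_ge0 (V^T *m V - 2%:M).
lra.
Qed.
End TriangleFree.

(** * Tight frames *)

Section TightFrame.
Variables (R : fieldType) (N n : nat) (X : 'M[R]_(N, n)) (c : R).
Hypotheses (c_neq0 : c != 0) (XX : X^T *m X = c%:M).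

(** [X X^T] is [c] times a projection; its rank cannot drop below [n] because
    [X^T (X X^T) X = c^2] is invertible of size [n]. *)
Lemma mxrank_tight : \rank (X *m X^T) = n.
Proof.
apply/eqP; rewrite eqn_leq; apply/andP; split.
  exact: leq_trans (mxrankM_maxl _ _) (rank_leq_col _).
have c2 : X^T *m (X *m X^T) *m X = (c * c)%:M.
  by rewrite mulmxA XX -mulmxA XX scalar_mxM.
have rc : \rank ((c * c)%:M : 'M[R]_n) = n.
  by apply: mxrank_unit; rewrite unitmxE det_scalar unitrX // unitfE mulf_neq0.
rewrite -[leqLHS]rc -c2.
by apply: leq_trans (mxrankM_maxl _ _) (mxrankM_maxr _ _).
Qed.

(** [X X^T] satisfies [G^2 = c G], and the rows of [X^T] are eigenvectors for
    [c]. *)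
Lemma eigenvalue_tight (a : R) : (0 < n)%N ->
  (eigenvalue (X *m X^T) a /\ a != 0) <-> a = c.
Proof.
move=> n_gt0; split=> [[/eigenvalueP[v va v_neq0] a_neq0]|->].
  (* Multiplication by [c] and by [a] agree on the eigenvector [a v]. *)
  have GG : X *m X^T *m (X *m X^T) = c *: (X *m X^T).
    by rewrite mulmxA -(mulmxA X) XX mul_mx_scalar scalemxAl.
  have : a *: (a *: v) = c *: (a *: v).
    by rewrite -va [RHS]scalemxAr -GG [in RHS](mulmxA v) [in RHS]va -scalemxAl.
  move=> /eqP; rewrite !scalerA -subr_eq0 -scalerBl -mulrBl scaler_eq0 mulf_eq0.
  by rewrite (negbTE v_neq0) (negbTE a_neq0) !orbF subr_eq0 => /eqP.
split=> //; apply/eigenvalueP; exists (row (Ordinal n_gt0) X^T).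
  by rewrite -row_mul mulmxA XX mul_scalar_mx linearZ.
apply: contra_neq c_neq0 => X0.
have := congr1 (fun M : 'M_n => M (Ordinal n_gt0) (Ordinal n_gt0)) XX.
rewrite /= [in RHS]mxE eqxx mulr1n => <-; rewrite mxE big1 // => j _.
have := congr1 (fun M : 'rV_N => M 0 j) X0.
by rewrite !mxE => ->; rewrite mul0r.
Qed.
End TightFrame.

(** * Lifting an almost equiangular set by one dimension *)

Lemma gramE (R : realType) (n N : nat) (x : 'I_N -> 'rV[R]_n)
  (X := \matrix_i x i) : gram x = X *m X^T.
Proof.
apply/matrixP => i j; rewrite !mxE; apply: eq_bigr => k _.
by rewrite !mxE.
Qed.

Lemma dot_sphere (R : realType) (n : nat) (t : R) (S : set 'rV[R]_n) :
  almost_equiangular t S -> forall x, S x -> dot x x = 1.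
Proof.
move=> [/[swap] _ sph] x /sph /= e1.
have d0 : 0 <= dot x x.
  by apply: sumr_ge0 => i _; rewrite -expr2 sqr_ge0.
by rewrite -(sqr_sqrtr d0) -/(enorm x) e1 expr1n.
Qed.

Lemma extremal_parameter (R : realFieldType) (t m : R) : m != 0 -> 1 - t != 0 ->
  (1 - t)^-1 * - t * (2 * (m + 1)) = 2 -> t = - m^-1.
Proof.
move=> m0 t1; rewrite -mulrA => /(canRL (mulVKf t1)) h.
have tm : t * m = -1 by lra.
by apply: (mulIf m0); rewrite tm mulNr mulVf.
Qed.

Section Enumeration.
Variables (R : realType) (n N : nat) (t : R) (S : set 'rV[R]_n).
Variable x : 'I_N -> 'rV[R]_n.
Hypotheses (t_le0 : t <= 0) (S_ae : almost_equiangular t S).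
Hypotheses (x_inj : injective x) (xS : forall i, S (x i)).
Let X := \matrix_i x i.
Let e : 'cV[R]_N := const_mx 1.

(** The extra coordinate raises all inner products by [- t >= 0] before the
    normalization, turning the value [t] into [0]. *)
Let V := Num.sqrt (1 - t)^-1 *: row_mx X (Num.sqrt (- t) *: e).

Let subt_gt0 : 0 < 1 - t.
Proof. by rewrite subr_gt0 (le_lt_trans t_le0) ?ltr01. Qed.

Let lift_mulmx_tr : V *m V^T = (1 - t)^-1 *: (gram x - t *: const_mx 1).
Proof.
have t1 : 0 <= (1 - t)^-1 by rewrite invr_ge0 ltW.
rewrite /V linearZ /= -scalemxAl -scalemxAr scalerA -expr2 sqr_sqrtr //.
rewrite tr_row_mx mul_row_col gramE linearZ /= -scalemxAl -scalemxAr scalerA.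
rewrite -expr2 sqr_sqrtr ?oppr_ge0 // scaleNr; congr (_ *: (_ - _ *: _)).
by apply/matrixP=> i j; rewrite !mxE big_ord1 !mxE mulr1.
Qed.

Let lift_unit i : (V *m V^T) i i = 1.
Proof.
rewrite lift_mulmx_tr !mxE (dot_sphere S_ae) // mulr1 mulVf //.
exact: lt0r_neq0.
Qed.

Let lift_triangle i j k : i != j -> j != k -> k != i ->
  (V *m V^T) i j * (V *m V^T) j k * (V *m V^T) k i = 0.
Proof.
move=> ij jk ki; rewrite lift_mulmx_tr !mxE !mulr1.
have xneq a b : a != b -> x a <> x b by move=> /eqP ab /x_inj.
have [] := S_ae.2 (x i) (x j) (x k) (xS i) (xS j) (xS k).
- exact: xneq.
- by apply: xneq; rewrite eq_sym.
- exact: xneq.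
- by move=> ->; rewrite subrr mulr0 !mul0r.
- move=> ik; suff -> : dot (x k) (x i) = t by rewrite subrr !mulr0.
  by rewrite -ik; apply: eq_bigr => l _; rewrite mulrC.
- by move=> ->; rewrite subrr !mulr0 mul0r.
Qed.

Lemma almost_equiangular_leq : (N <= 2 * (n + 1))%N.
Proof. exact: triangle_free_bound lift_unit lift_triangle. Qed.

(** The four blocks of [V^T V = 2]: the lower right one determines [t], and
    then [sqrt (- t)] is nonzero, so the upper right one gives [X^T e = 0]. *)
Lemma almost_equiangular_extremal : (0 < n)%N -> N = (2 * (n + 1))%N ->
  [/\ t = - n%:R^-1, X^T *m X = (2 * (1 + n%:R^-1))%:M & X^T *m e = 0].
Proof.
move=> n_gt0 NE.
have n_neq0 : n%:R != 0 :> R by rewrite pnatr_eq0 -lt0n.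
have t1 : 1 - t != 0 by exact: lt0r_neq0.
have := triangle_free_extremal lift_unit lift_triangle NE.
rewrite /V -scalemxAr [_^T]linearZ /= -scalemxAl scalerA -expr2.
rewrite sqr_sqrtr; last by rewrite invr_ge0 ltW.
rewrite tr_row_mx mul_col_row scalar_mx_block scale_block_mx.
move=> /eq_block_mx[XX Xe _ ee].
have tE : t = - n%:R^-1.
  move: ee; rewrite -scalemxAr [_^T]linearZ /= -scalemxAl !scalerA -mulrA -expr2.
  rewrite sqr_sqrtr ?oppr_ge0 // => /(congr1 (fun M : 'M_1 => M 0 0)).
  rewrite !mxE (eq_bigr (fun=> 1)); last by move=> i _; rewrite !mxE mulr1.
  rewrite sumr_const card_ord NE natrM natrD eqxx.
  exact: extremal_parameter.
split=> //.
- move/(canRL (scalerKV t1)): XX => ->.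
  rewrite tE scale_scalar_mx; congr (_%:M); ring.
- have s0 : Num.sqrt (- t) != 0.
    by rewrite tE opprK gt_eqF // sqrtr_gt0 invr_gt0 ltr0n.
  move: Xe; rewrite -scalemxAr scalerA => /eqP; rewrite scaler_eq0 mulf_eq0.
  by rewrite invr_eq0 (negbTE t1) (negbTE s0) => /eqP.
Qed.
End Enumeration.

(** * Counting points of possibly infinite sets *)

Lemma card_eq_enum (T : Type) (S : set T) (N : nat) :
  (S #= `I_N)%card -> exists2 x : 'I_N -> T, injective x & range x = S.
Proof.
move=> /card_esym /card_eqP[f].
pose mk (i : 'I_N) : set_type `I_N := SigSub (mem_set (ltn_ord i : `I_N i)).
exists (fun i => val (f (mk i))).
  move=> i j /val_inj /(in2TT 'inj_f) /(congr1 val) /=; exact: val_inj.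
apply/seteqP; split=> [_ [i _ <-]|s Ss]; first exact: set_valP.
have [[k kN] _ fk] : (f @` [set: set_type `I_N]) (SigSub (mem_set Ss)).
  exact: 'surj_f.
exists (Ordinal (set_mem kN)) => //=.
have -> : s = val (SigSub (mem_set Ss)) by [].
by rewrite -fk; congr (val (f _)); apply: val_inj.
Qed.

(** Stated through an embedding of an initial segment of the naturals, so that
    it also constrains infinite sets. *)
Lemma almost_equiangular_card_le (R : realType) (n N : nat) (t : R)
    (S : set 'rV[R]_n) :
  t <= 0 -> almost_equiangular t S -> (`I_N #<= S)%card -> (N <= 2 * (n + 1))%N.
Proof.
move=> t_le0 S_ae /card_subP[C CN CS].
have [x x_inj xC] := card_eq_enum CN.
apply: (almost_equiangular_leq t_le0 S_ae x_inj) => i.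
by apply: CS; rewrite -xC; exists i.
Qed.

(** An infinite set would contain [2 (n + 1) + 1] points. *)
Lemma almost_equiangular_finite (R : realType) (n : nat) (t : R)
    (S : set 'rV[R]_n) :
  t <= 0 -> almost_equiangular t S -> finite_set S.
Proof.
move=> t_le0 S_ae; apply/finite_setPn => nat_S.
have : (`I_(2 * (n + 1)).+1 #<= S)%card.
  by apply: card_le_trans nat_S; apply: subset_card_le.
by move=> /(almost_equiangular_card_le t_le0 S_ae); rewrite ltnn.
Qed.

Lemma is_alpha_exists (R : realType) (n : nat) (t : R) :
  t <= 0 -> exists2 a, is_alpha n t a & (a <= 2 * (n + 1))%N.
Proof.
move=> t_le0.
pose P k := `[< exists2 S : set 'rV[R]_n,
  almost_equiangular t S & (S #= `I_k)%card >].
have P0 : exists k, P k.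
  exists 0; apply/asboolP; exists set0; last by rewrite II0.
  by split=> [x|x y z].
have P_le k : P k -> (k <= 2 * (n + 1))%N.
  move=> /asboolP[S S_ae Sk]; apply: almost_equiangular_card_le t_le0 S_ae _.
  by rewrite (card_le_eqr Sk).
have [a /asboolP Pa a_max] := ex_maxnP P0 P_le.
exists a; last by apply: P_le; apply/asboolP.
split=> // S S_ae.
have /finite_setP[k Sk] := almost_equiangular_finite t_le0 S_ae.
rewrite (card_le_eql Sk) card_le_II; apply: a_max.
by apply/asboolP; exists S.
Qed.

Lemma barycenter_enum (R : realType) (n N : nat) (x : 'I_N -> 'rV[R]_n) :
    injective x -> (\matrix_i x i)^T *m (const_mx 1 : 'cV_N) = 0 ->
  barycenter (range x) = 0.
Proof.
move=> x_inj Xe.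
have x_bij : set_bij [set: 'I_N] (range x) x.
  by split=> // i j _ _; exact: x_inj.
rewrite /barycenter; suff -> : \sum_(y \in range x) y = 0 by rewrite scaler0.
rewrite (reindex_fsbig x [set: 'I_N]) //.
rewrite (fsbigE (index_enum 'I_N)) ?index_enum_uniq //; last first.
  by move=> i _; rewrite mem_index_enum.
rewrite (eq_bigl xpredT) => [|i]; last by rewrite in_setT.
apply/rowP => k; have := congr1 (fun M : 'cV_n => M k 0) Xe.
rewrite !mxE summxE => Xk; rewrite -[RHS]Xk; apply: eq_bigr => i _.
by rewrite !mxE mulr1.
Qed.

Theorem theorem6p1 (R : realType) (n : nat) (hn : (2 <= n)%N) :
  (forall t : R, -1 <= t <= 0 ->
     exists a : nat,
       [/\ is_alpha n t a,
           (a <= 2 * (n + 1))%N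
         & a = (2 * (n + 1))%N -> t = - n%:R^-1])
  /\
  (forall S : set 'rV[R]_n, max_obtuse S ->
     (forall x : 'I_(2 * (n + 1)) -> 'rV[R]_n, injective x -> range x = S ->
        [/\ \rank (gram x) = n,
            forall c : R,
              (eigenvalue (gram x) c /\ c != 0) <-> c = 2 * (1 + n%:R^-1)
          & gram x *m (const_mx 1 : 'cV[R]_(2 * (n + 1))) = 0])
     /\ barycenter S = 0).
Proof.
have n_gt0 : (0 < n)%N by exact: leq_trans hn.
split=> [t /andP[_ t_le0]|S [S_ae SN]].
  have [a a_alpha a_le] := is_alpha_exists n t_le0.
  exists a; split=> // aN; have [[S S_ae Sa] _] := a_alpha.
  have [x x_inj xS] := card_eq_enum Sa.
  have Sx i : S (x i) by rewrite -xS; exists i.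
  by have [] := almost_equiangular_extremal t_le0 S_ae x_inj Sx n_gt0 aN.
have t_le0 : - n%:R^-1 <= 0 :> R by rewrite oppr_le0 invr_ge0 ler0n.
have c_neq0 : 2 * (1 + n%:R^-1) != 0 :> R.
  by rewrite mulf_neq0 ?pnatr_eq0 // gt_eqF // addr_gt0 ?ltr01 ?invr_gt0 ?ltr0n.
have extremal (x : 'I_(2 * (n + 1)) -> 'rV[R]_n) : injective x -> range x = S ->
    (\matrix_i x i)^T *m (\matrix_i x i) = (2 * (1 + n%:R^-1))%:M /\
    (\matrix_i x i)^T *m (const_mx 1 : 'cV_(2 * (n + 1))) = 0.
  move=> x_inj xS; have Sx i : S (x i) by rewrite -xS; exists i.
  by have [] := almost_equiangular_extremal t_le0 S_ae x_inj Sx n_gt0 erefl.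
split=> [x x_inj xS|].
  have [XX Xe] := extremal x x_inj xS; rewrite gramE; split.
  - exact: mxrank_tight c_neq0 XX.
  - by move=> c; exact: eigenvalue_tight c_neq0 XX c n_gt0.
  - by rewrite -mulmxA Xe mulmx0.
have [x x_inj xS] := card_eq_enum SN.
by rewrite -xS; apply: barycenter_enum => //; have [] := extremal x x_inj xS.
Qed.
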